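(* Let $A$ be a finite abelian group and $B$ a subgroup of $A$ of index $2$. Suppose that either $A\cong C_4\times C_2^\ell$ for some $\ell\ge 1$ and $B\cong C_2^{\ell+1}$, or $A\cong C_4^2\times C_2^\ell$ for some $\ell\ge 0$ and $B\cong C_4\times C_2^{\ell+1}$. Then there is no inverse-closed subset $S\subseteq A\setminus B$ such that $|\mathrm{Aut}(\mathrm{Cay}(A,S)):A|=2$.
   Context: $C_t$ denotes the cyclic group of order $t$. For a finite group $G$ and $S\subseteq G$, the Cayley digraph $\mathrm{Cay}(G,S)$ has vertex set $G$ and an arc $(g,h)$ if and only if $gh^{-1}\in S$; when $S=S^{-1}:=\{s^{-1}\mid s\in S\}$ it is an (undirected) graph. The group $G$ acts regularly on it by right multiplication and is identified with this subgroup of $\mathrm{Aut}(\mathrm{Cay}(G,S))$. *)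

(* Defs.v *)
From mathcomp Require Import all_boot all_fingroup all_algebra all_solvable.

Set Implicit Arguments.
Unset Strict Implicit.
Unset Printing Implicit Defensive.

Local Open Scope group_scope.

Definition Cay (gT : finGroupType) (S : {set gT}) : rel gT :=
  [rel g h | g * h^-1 \in S].

Section DigraphAut.

Variables (T : finType) (e : rel T).

Definition digraph_aut : {set {perm T}} :=
  [set p : {perm T} | [forall x, forall y, e (p x) (p y) == e x y]].

Lemma digraph_aut_group_set : group_set digraph_aut.
Proof.
apply/group_setP; split=> [|p q]; rewrite !inE.
  by apply/forallP=> x; apply/forallP=> y; rewrite !perm1.
move=> /forallP Ap /forallP Aq; apply/forallP=> x; apply/forallP=> y.
by rewrite !permM (eqP (forallP (Aq _) _)) (eqP (forallP (Ap _) _)).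
Qed.

Canonical digraph_aut_group := group digraph_aut_group_set.

End DigraphAut.

(* The permutations x |-> x * a of the whole of gT, for a in gT. *)
Definition right_regular (gT : finGroupType) : {group {perm gT}} :=
  [group of actperm 'R @* [set: gT]].

Lemma right_regular_sub_aut (gT : finGroupType) (S : {set gT}) :
  right_regular gT \subset digraph_aut (Cay S).
Proof.
apply/subsetP=> _ /morphimP[a _ _ ->]; rewrite inE.
apply/forallP=> x; apply/forallP=> y.
by rewrite !actpermE /Cay /= /mulgr_action /= invMg mulgA mulgK.
Qed.

(* The direct power gT ^ l, with componentwise group law. *)
Notation dpower gT l := {dffun forall _ : 'I_l, gT}.

(* Main.v *)
(** A permutation fixing a subgroup [H] pointwise and translating by [w \in H]
    outside [H] is an automorphism of [Cay A S] as soon as [S :\: H] is stable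
    under [w]. Since [S] is inverse-closed, this is the case when [w] is an
    involution and all elements of [S :\: H] have square [w]. If [B] is
    elementary abelian, all elements outside [B] have the same square [z], and
    [w = z] with [H = <[z]>] or [H = B] will do. Otherwise the squares of [B] are
    [1, u] and those outside [B] are [v, u * v]; take [w] to be either of the
    latter and [H] the set of elements whose square is [1] or the other one.
    Together with the identity this gives three automorphisms fixing [1], hence
    in three distinct cosets of the regular subgroup, whose index exceeds 2. *)
Require Import Defs.
From mathcomp Require Import all_boot all_fingroup all_algebra all_solvable.

Set Implicit Arguments.
Unset Strict Implicit.

Local Open Scope group_scope.

(** * Permutations that translate the complement of a subgroup *)

Section CosetTwist.

Variables (gT : finGroupType) (H : {group gT}) (w : gT).
Hypothesis Hw : w \in H.

Definition coset_twist (x : gT) : gT := if x \in H then x else w * x.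

Lemma coset_twist_mem (x : gT) : (coset_twist x \in H) = (x \in H).
Proof. by rewrite /coset_twist; case: ifP => // Hx; rewrite groupMl. Qed.

Lemma coset_twist_inj : injective coset_twist.
Proof.
move=> x y exy; have := coset_twist_mem x; rewrite exy coset_twist_mem.
by move: exy; rewrite /coset_twist => + eH; rewrite eH; case: ifP => // _ /mulgI.
Qed.

Definition twist_perm : {perm gT} := perm coset_twist_inj.

(** The fixed points recover [H]: this later tells twists apart from each other and from regular
    permutations. *)
Lemma twist_perm_fix (x : gT) : w != 1 -> (twist_perm x == x) = (x \in H).
Proof.
move=> w1; rewrite permE /coset_twist; case: ifP => Hx; first exact: eqxx.
by rewrite -{2}[x]mul1g (inj_eq (mulIg x)) (negPf w1).
Qed.

(** If [x] and [y] are both in [H] or both outside it, [x * y^-1] is unchanged by commutativity. If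
    exactly one is outside, this quotient lies outside [H] and is multiplied by [w] or [w^-1], which
    does not affect membership in [S]. *)
Lemma twist_perm_aut (S : {set gT}) :
    abelian [set: gT] ->
    (forall x, x \notin H -> (w * x \in S) = (x \in S)) ->
  twist_perm \in digraph_aut (Cay S).
Proof.
move=> cA Sw; have comm (x y : gT) : x * y = y * x.
  by apply: (centsP cA); rewrite inE.
rewrite inE; apply/forallP => x; apply/forallP => y; apply/eqP.
rewrite !permE /Cay /= /coset_twist.
case: ifP => Hx; case: ifP => Hy //.
- have nH : x * (w * y)^-1 \notin H.
    by rewrite groupMl // groupV groupMl // Hy.
  by rewrite -Sw // invMg [x * _]mulgA [w * _]comm mulgKV.
- by rewrite -mulgA Sw // groupMr ?Hx // groupV.
- by rewrite invMg mulgA -[w * x * _]mulgA [w * _]comm mulgK.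
Qed.

End CosetTwist.

Lemma right_regular_fix1 (gT : finGroupType) (p : {perm gT}) :
  p \in right_regular gT -> p 1 = 1 -> p = 1.
Proof.
case/morphimP => a _ _ ->; rewrite actpermE /= /mulgr_action mul1g => ->.
exact: morph1.
Qed.

(** * Two distinct twists exclude index 2 *)

Section InverseClosed.

Variables (gT : finGroupType) (S : {set gT}).
Hypotheses (cA : abelian [set: gT]) (SV : S^-1 = S).

(** For [x] in [S] outside [H], [w = w^-1 = x^-2], so translating by [w] is the same as inverting
    [x]. *)
Lemma involution_mul_stable (H : {group gT}) (w : gT) :
    w \in H -> w ^+ 2 = 1 -> {in S, forall x, x \notin H -> x ^+ 2 = w} ->
  forall x, x \notin H -> (w * x \in S) = (x \in S).
Proof.
move=> Hw w2 Sw; have sub x : x \notin H -> x \in S -> w * x \in S.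
  move=> Hx Sx; have xx := Sw x Sx Hx.
  suff -> : w * x = x^-1 by rewrite -SV memV_invg.
  have wV : w = w^-1 by apply/(mulgI w); rewrite mulgV -expg2.
  by rewrite wV -xx expg2 invMg mulgKV.
(* The converse is [sub] applied to [w * x], since [w] squares to [1]. *)
move=> x Hx; apply/idP/idP; last exact: sub.
move/(sub (w * x)); rewrite mulgA -expg2 w2 mul1g; apply.
by rewrite groupMl.
Qed.

(** With index 2, both twists would lie in the single nontrivial coset of the regular subgroup.
    Their quotient would then be regular and fix [1], so the twists, and with them their fixed point
    sets [H1] and [H2], would coincide. *)
Lemma two_twists_index (H1 H2 : {group gT}) (w1 w2 : gT) :
    H1 :!=: H2 -> H1 \proper [set: gT] -> H2 \proper [set: gT] ->
    w1 \in H1 -> w2 \in H2 -> w1 != 1 -> w2 != 1 ->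
    w1 ^+ 2 = 1 -> w2 ^+ 2 = 1 ->
    {in S, forall x, x \notin H1 -> x ^+ 2 = w1} ->
    {in S, forall x, x \notin H2 -> x ^+ 2 = w2} ->
  #|digraph_aut (Cay S) : right_regular gT| <> 2.
Proof.
move=> neqH pH1 pH2 Hw1 Hw2 n1 n2 e1 e2 S1 S2 index2.
(* The twist fixes [1] but moves every element outside the proper subgroup [H]. *)
have notR (H : {group gT}) w (Hw : w \in H) : w != 1 -> H \proper [set: gT] ->
    twist_perm Hw \notin right_regular gT.
  move=> w1' /properP[_ [x _ Hx]]; apply: contra Hx => /right_regular_fix1 p1.
  rewrite -(twist_perm_fix Hw) // p1 ?perm1 //.
  by apply/eqP; rewrite twist_perm_fix.
have R1 := notR _ _ Hw1 n1 pH1; have R2 := notR _ _ Hw2 n2 pH2.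
have A1 := twist_perm_aut Hw1 cA (involution_mul_stable Hw1 e1 S1).
have A2 := twist_perm_aut Hw2 cA (involution_mul_stable Hw2 e2 S2).
have : twist_perm Hw1 \in right_regular gT :* twist_perm Hw2.
  by rewrite (rcoset_index2 (right_regular_sub_aut S) index2); apply/setDP.
rewrite mem_rcoset => /right_regular_fix1 p12.
case/eqP: neqH; apply/setP => x.
rewrite -(twist_perm_fix Hw1) // -(twist_perm_fix Hw2) //.
suff -> : twist_perm Hw1 = twist_perm Hw2 by [].
apply/(mulIg (twist_perm Hw2)^-1); rewrite mulgV p12 // permM.
have fix1 (H : {group gT}) w (Hw : w \in H) : w != 1 -> twist_perm Hw 1 = 1.
  by move=> w1'; apply/eqP; rewrite twist_perm_fix.
by rewrite fix1 // -{1}(fix1 _ _ Hw2) // permK.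
Qed.

End InverseClosed.

(** * Counting squares, an isomorphism invariant *)

Definition squares {gT : finGroupType} (G : {set gT}) : {set gT} :=
  [set x ^+ 2 | x in G].

Lemma mem_squares (gT : finGroupType) (G : {set gT}) (x : gT) :
  x \in G -> x ^+ 2 \in squares G.
Proof. exact: imset_f. Qed.

Lemma card_squares_isog (aT rT : finGroupType) (G : {group aT}) (H : {group rT}) :
  G \isog H -> #|squares G| = #|squares H|.
Proof.
case/isogP => f injf <-.
have -> : squares (f @* G) = f @: squares G.
  rewrite morphimEdom; apply/setP => y; apply/imsetP/imsetP => [[_ /imsetP[x Gx ->] ->]|].
    by exists (x ^+ 2); [apply: imset_f | rewrite morphX].
  case=> _ /imsetP[x Gx ->] ->; exists (f x); first exact: imset_f.
  by rewrite morphX.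
rewrite card_in_imset // => _ _ /imsetP[x Gx ->] /imsetP[y Gy ->].
by apply: (injmP injf); rewrite groupX.
Qed.

Lemma card_squares_prod (aT rT : finGroupType) :
  #|squares [set: aT * rT]| = (#|squares [set: aT]| * #|squares [set: rT]|)%N.
Proof.
rewrite -cardsX; congr #|pred_of_set _|; apply/setP => -[x y]; rewrite in_setX.
apply/imsetP/andP => [[[a b] _ [-> ->]]|[/imsetP[a _ ->] /imsetP[b _ ->]]].
  by split; apply: imset_f.
by exists (a, b).
Qed.

Lemma expg2_dpower_Z2 (l : nat) (x : dpower 'Z_2 l) : x ^+ 2 = 1.
Proof.
by apply/ffunP => i; rewrite expg2 !ffunE; case: (x i) => -[|[|//]] /= ?; apply: val_inj.
Qed.

Lemma squares_dpower_Z2 (l : nat) : squares [set: dpower 'Z_2 l] = 1.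
Proof.
apply/setP => x; rewrite inE; apply/imsetP/eqP => [[y _ ->] | ->].
  exact: expg2_dpower_Z2.
by exists 1; rewrite ?expg1n.
Qed.

Lemma expg4_Z4 (x : 'Z_4) : x ^+ 4 = 1.
Proof. by case: x => -[|[|[|[|//]]]] ?; apply: val_inj. Qed.

Lemma card_squares_Z4 : #|squares [set: 'Z_4]| = 2.
Proof.
rewrite [squares _](_ : _ = [set 1; inZp 2]) ?cards2 //.
apply/setP => x; rewrite !inE; apply/imsetP/orP => [[y _ ->]|].
  by case: y => -[|[|[|[|//]]]] /= ?; [left|right|left|right].
by case=> /eqP ->; [exists 1 | exists (inZp 1)] => //; apply: val_inj.
Qed.

Lemma card_dpower_Z2 (l : nat) : #|[set: dpower 'Z_2 l]| = (2 ^ l)%N.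
Proof. by rewrite cardsT card_ffun !card_ord. Qed.

(** * Squares inside and outside a subgroup of index 2 *)

Section IndexTwo.

Variables (gT : finGroupType) (B : {group gT}) (S : {set gT}).
Hypotheses (cA : abelian [set: gT]) (iB : #|[set: gT] : B| = 2).
Hypotheses (SV : S^-1 = S) (sSB : S \subset [set: gT] :\: B).

Lemma proper_index2 : B \proper [set: gT].
Proof.
by rewrite properEneq subsetT andbT; apply: contra_eqN iB => /eqP <-; rewrite indexgg.
Qed.

Lemma squareM (x y : gT) : (x * y) ^+ 2 = x ^+ 2 * y ^+ 2.
Proof. by rewrite expgMn //; apply: (centsP cA); rewrite inE. Qed.

Lemma mem_coset_index2 (a x : gT) : a \notin B -> x \notin B -> x * a^-1 \in B.
Proof.
by move=> Ba Bx; rewrite -mem_rcoset (rcoset_index2 (subsetT B) iB) !inE ?Ba ?Bx.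
Qed.

Lemma square_index2 (a : gT) : a ^+ 2 \in B.
Proof.
have [Ba|Ba] := boolP (a \in B); first exact: groupX.
(* Both [a] and [a^-1] are outside [B], so [a^-1 * a^-1] lies in [B]. *)
by have := mem_coset_index2 (x := a^-1) Ba; rewrite groupV -invMg groupV -expg2; apply.
Qed.

Lemma square_coset_index2 (a x : gT) :
  a \notin B -> x \notin B -> exists2 b, b \in B & x ^+ 2 = b ^+ 2 * a ^+ 2.
Proof.
move=> Ba Bx; exists (x * a^-1); first exact: mem_coset_index2.
by rewrite -squareM mulgKV.
Qed.

Lemma index_of_squares21 :
    #|squares [set: gT]| = 2 -> squares B = 1 -> 2 < #|B| ->
  #|digraph_aut (Cay S) : right_regular gT| <> 2.
Proof.
move=> sqA sqB cB; have [_ [a _ Ba]] := properP proper_index2.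
have B2 b : b \in B -> b ^+ 2 = 1.
  by move=> Bb; apply/set1P; rewrite -[[set 1]]sqB mem_squares.
have nB2 x : x \notin B -> x ^+ 2 = a ^+ 2.
  by move=> Bx; have [b Bb ->] := square_coset_index2 Ba Bx; rewrite B2 // mul1g.
(* Otherwise [1] would be the only square in the whole group. *)
have z1 : a ^+ 2 != 1.
  apply/eqP => a1; have : squares [set: gT] \subset [set 1].
    apply/subsetP => _ /imsetP[x _ ->]; rewrite inE.
    by have [/B2 ->|/nB2 ->] := boolP (x \in B); rewrite ?a1.
  by move/subset_leq_card; rewrite sqA cards1.
have z2 : (a ^+ 2) ^+ 2 = 1 by rewrite B2 ?square_index2.
have oz : #[a ^+ 2] = 2 by apply: nt_prime_order.
(* The bound on the order of [B] makes the two candidate subgroups distinct. *)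
have neq : <[a ^+ 2]> != B by apply: contraTneq cB => <-; rewrite -[#|_|]/(#[_]) oz.
apply: (@two_twists_index _ _ cA SV <[a ^+ 2]> B (a ^+ 2) (a ^+ 2)) => //.
- by apply: sub_proper_trans proper_index2; rewrite cycle_subG square_index2.
- exact: proper_index2.
- exact: cycle_id.
- exact: square_index2.
- by move=> x /(subsetP sSB)/setDP[_ Bx] _; apply: nB2.
- by move=> x _; apply: nB2.
Qed.

(** Squaring is an endomorphism of an abelian group, and this set is the preimage of [K]. *)
Lemma square_roots_group_set (K : {group gT}) :
  group_set [set x : gT | x ^+ 2 \in K].
Proof.
apply/group_setP; split=> [|x y]; rewrite !inE ?expg1n ?group1 // squareM.
exact: groupM.
Qed.

Lemma index_of_squares42 :
    (forall x : gT, x ^+ 4 = 1) -> #|squares [set: gT]| = 4 -> #|squares B| = 2 ->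
  #|digraph_aut (Cay S) : right_regular gT| <> 2.
Proof.
move=> exp4 sqA sqB; have [_ [a _ Ba]] := properP proper_index2.
have inv2 (x : gT) : (x ^+ 2) ^+ 2 = 1 by rewrite -expgM exp4.
have [b0 Bb0 u1] : exists2 b, b \in B & b ^+ 2 != 1.
  apply/exists_inP; apply: contra_eqT sqB => /exists_inPn B1.
  have /subset_leq_card : squares B \subset [set 1].
    by apply/subsetP => _ /imsetP[x /B1 + ->]; rewrite inE negbK.
  by rewrite cards1; case: #|_| => [|[]].
set u := b0 ^+ 2 in u1; pose v := a ^+ 2; pose w := u * v.
have v2 : v ^+ 2 = 1 by apply: inv2.
have w2 : w ^+ 2 = 1 by rewrite /w -squareM inv2.
have sqBE : squares B = [set 1; u].
  apply/eqP; rewrite eq_sym eqEcard sqB cards2 eq_sym u1 andbT subUset !sub1set.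
  by rewrite mem_squares // andbT -[1](expg1n _ 2) mem_squares.
have B2 b : b \in B -> b ^+ 2 = 1 \/ b ^+ 2 = u.
  by move=> Bb; apply/set2P; rewrite -sqBE mem_squares.
have nB2 x : x \notin B -> x ^+ 2 = v \/ x ^+ 2 = w.
  move=> Bx; have [b /B2[] -> ->] := square_coset_index2 Ba Bx; last by right.
  by left; rewrite mul1g.
(* Otherwise [v] and [w] both lie in the subgroup [[set 1; u]], leaving at most two squares instead
   of four. *)
have vB : v \notin [set 1; u].
  apply: contra_eqN sqA => vu; have /subset_leq_card : squares [set: gT] \subset [set 1; u].
    have uu : u * u = 1 by rewrite -expg2 inv2.
    apply/subsetP => _ /imsetP[x _ ->]; move: vu; rewrite !inE.
    have [/B2[] ->|/nB2[] -> //] := boolP (x \in B); rewrite ?eqxx ?orbT //.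
    by rewrite /w; case/orP => /eqP ->; rewrite ?mulg1 ?uu eqxx ?orbT.
  by rewrite cards2 eq_sym u1; case: #|_| => [|[|[|]]].
have /norP[v1 vu] : ~~ ((v == 1) || (v == u)) by rewrite !inE in vB.
have w1 : w != 1.
  apply: contraNneq vu => uv; apply/eqP/(mulgI u); rewrite -/w uv.
  by rewrite -expg2 inv2.
have wv : w != v by rewrite /w -{2}[v]mul1g (inj_eq (mulIg v)).
pose H1 := group (square_roots_group_set <[v]>).
pose H2 := group (square_roots_group_set <[w]>).
have cyc2 z : z != 1 -> z ^+ 2 = 1 -> <[z]> = [set 1; z].
  by move=> z1 z2; apply: cycle2g; apply: nt_prime_order.
have H1E x : (x \in H1) = (x ^+ 2 == 1) || (x ^+ 2 == v) by rewrite inE /= cyc2 // !inE.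
have H2E x : (x \in H2) = (x ^+ 2 == 1) || (x ^+ 2 == w) by rewrite inE /= cyc2 // !inE.
(* [a], of square [v], separates [H1] from [H2]; [b0 * a], of square [w], shows that [H1] is
   proper. *)
have H1a : a \in H1 by rewrite H1E eqxx orbT.
have H2a : a \notin H2 by rewrite H2E -/v negb_or v1 eq_sym.
have H1c : b0 * a \notin H1 by rewrite H1E squareM -/u -/v -/w negb_or w1.
have nSB x : x \in S -> x ^+ 2 = v \/ x ^+ 2 = w.
  by move=> /(subsetP sSB)/setDP[_ /nB2].
(* The translations are crossed: elements of [S] outside [H1] have square [w], those outside [H2]
   have square [v]. *)
apply: (@two_twists_index _ _ cA SV H1 H2 w v) => //.
- by apply: contraNneq H2a => <-.
- by apply/properP; split; [exact: subsetT | exists (b0 * a); rewrite ?in_setT].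
- by apply/properP; split; [exact: subsetT | exists a; rewrite ?in_setT].
- by rewrite H1E w2 eqxx.
- by rewrite H2E v2 eqxx.
- by move=> x /nSB[] ex; rewrite H1E ex ?eqxx ?orbT.
- by move=> x /nSB[] ex; rewrite H2E ex ?eqxx ?orbT.
Qed.

End IndexTwo.

Theorem theorem1p8 (A : finGroupType) (B : {group A}) :
  abelian [set: A] ->
  #|[set: A] : B| = 2 ->
  (exists l : nat, [/\ (1 <= l)%N,
       [set: A] \isog [set: 'Z_4 * dpower 'Z_2 l]
     & B \isog [set: dpower 'Z_2 l.+1]])
  \/ (exists l : nat,
       [set: A] \isog [set: 'Z_4 * 'Z_4 * dpower 'Z_2 l]
     /\ B \isog [set: 'Z_4 * dpower 'Z_2 l.+1]) ->
  ~ (exists S : {set A},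
       [/\ S^-1 = S,
           S \subset [set: A] :\: B
         & #|digraph_aut (Cay S) : right_regular A| = 2]).
Proof.
move=> cA iB AB [S [SV sSB]].
case: AB => [[l [l1 isoA isoB]]|[l [isoA isoB]]].
  apply: (index_of_squares21 cA iB SV sSB).
  - by rewrite (card_squares_isog isoA) card_squares_prod card_squares_Z4
               squares_dpower_Z2 cards1.
  - have : #|squares B| = 1%N.
      by rewrite (card_squares_isog isoB) squares_dpower_Z2 cards1.
    (* The only square in [B] must be that of [1]. *)
    move/eqP/cards1P => [x sqB]; have := mem_squares (group1 B).
    by rewrite expg1n sqB inE => /eqP <-.
  (* Here [1 <= l] gives [2 < 2 ^ l.+1]. *)
  - by rewrite (card_isog isoB) card_dpower_Z2 expnS ltn_Pmulr // -(expn0 2) ltn_exp2l.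
apply: (index_of_squares42 cA iB SV sSB).
- move=> x; apply: (exponentP _ x (in_setT x)); rewrite (exponent_isog isoA).
  apply/exponentP => -[[a b] c] _; congr (_, _, _); [exact: expg4_Z4 | exact: expg4_Z4 |].
  by transitivity ((c ^+ 2) ^+ 2); [rewrite -expgM | rewrite !expg2_dpower_Z2].
- by rewrite (card_squares_isog isoA) !card_squares_prod card_squares_Z4
             squares_dpower_Z2 cards1.
- by rewrite (card_squares_isog isoB) card_squares_prod card_squares_Z4
             squares_dpower_Z2 cards1.
Qed.
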